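(* Let $B$ be a finite rank Bratteli diagram with incidence matrices $$F_n=\begin{pmatrix} D_n&0\\ A_n&C_n\end{pmatrix},\qquad n\ge1,$$ where $D_n$ and $C_n$ are primitive square matrices (of sizes independent of $n$) and $A_n\neq 0$ for all $n$. Let $B(D)$ and $B(C)$ be the subdiagrams with incidence matrices $\{D_n\}$ and $\{C_n\}$, with vertex sets $V_n(D)$, $V_n(C)$ at level $n$. Let $\mu$ be a probability invariant measure on $B(C)$ and $\widehat\mu$ its extension to $X_B$. Write $A_i=(a^{(i)}_{v,u})$ and set $$\alpha_i=\max\{a^{(i)}_{v,u}: v\in V_{i+1}(C),\,u\in V_i(D)\},\qquad \beta_i=\min\{a^{(i)}_{v,u}: v\in V_{i+1}(C),\,u\in V_i(D)\}.$$ Suppose that $B(C)$ and $B(D)$ are of exact finite rank, and that in each of these subdiagrams the tower heights have the same asymptotic growth: $\inf_{n,v,w}h_v^{(n)}/h_w^{(n)}>0$ where $v,w$ run over the vertices of $B(D)$ at level $n$, and also where $v,w$ run over the vertices of $B(C)$ at level $n$, with $h_v^{(n)},h_w^{(n)}$ denoting the heights of towers within the corresponding subdiagram. (i) If $\displaystyle\sum_{i=1}^\infty\alpha_i\frac{\|D_{i-1}\cdots D_1\|_1}{\|C_i\cdots C_1\|_1}<\infty$, then $\widehat\mu(X_B)$ is finite. (ii) If $\widehat\mu(X_B)$ is finite, then $\displaystyle\sum_{i=1}^\infty\beta_i\frac{\|D_{i-1}\cdots D_1\|_1}{\|C_i\cdots C_1\|_1}<\infty$.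
   Context: A Bratteli diagram $B=(V,E)$ is an infinite graph with vertex set $V=\bigsqcup_{i\ge 0}V_i$ and edge set $E=\bigsqcup_{i\ge 1}E_i$, all $V_i,E_i$ finite, $V_0=\{v_0\}$, with range and source maps $r(E_i)=V_i$, $s(E_i)=V_{i-1}$, $s^{-1}(v)\ne\emptyset$ for all $v$ and $r^{-1}(v)\ne\emptyset$ for $v\ne v_0$. $X_B$ is the space of infinite paths from $v_0$, topologized by cylinder sets. The incidence matrix $F_n$ has rows indexed by $V_{n+1}$, columns by $V_n$, and $(v,w)$ entry equal to the number of edges between $w\in V_n$ and $v\in V_{n+1}$. Standing assumptions: the same number $d$ of vertices at each level $n\ge1$; a single edge from $v_0$ to each vertex of $V_1$ (for $B$ and hence for the subdiagrams); $X_B$ has no isolated points; the tail equivalence relation $\mathcal E$ ($x\mathcal E y$ iff $x_n=y_n$ for all large $n$) has no finite classes. The height $h_v^{(n)}$ of the tower of a vertex $v$ at level $n$ within a diagram is the number of finite paths in that diagram from $v_0$ to $v$. $\|A\|_1=\sum_{i,j}|a_{i,j}|$ for a matrix $A$; an empty product of matrices is the identity matrix. A measure on a diagram is invariant if it is a Borel non-atomic measure on the path space giving equal mass to the cylinder sets of any two finite paths from $v_0$ with the same range. A diagram is of exact finite rank if it is of finite rank (uniformly bounded number of vertices per level) and there are a finite invariant measure $\nu$ and $\delta>0$ such that, after a telescoping (keeping a subsequence of levels and taking finite paths between consecutive kept levels as edges), the set of infinite paths through $v$ at level $n$ has $\nu$-measure at least $\delta$ for all levels $n\geq 1$ and vertices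 $v$ at level $n$. Extension: let $Y$ be the path space of $B(C)$. $\widehat\mu$ is the $\mathcal E$-invariant measure (finite or infinite), concentrated on the set of paths of $B$ cofinal to a path of $Y$, whose restriction to $Y$ is $\mu$. Its total mass is $\widehat\mu(X_B)=\lim_{n\to\infty}\sum_{w\in V_n(C)}\widehat h_w^{(n)}\mu([e(v_0,w)])$, where $\widehat h^{(n)}_w$ is the number of paths in $B$ from $v_0$ to $w$ and $[e(v_0,w)]\subset Y$ is the cylinder set of any finite path in $B(C)$ from $v_0$ to $w$. *)

(* Defs.v *)
From HB Require Import structures.
From mathcomp Require Import all_boot all_order all_algebra.
From mathcomp Require Import all_classical all_reals all_analysis.
Set Implicit Arguments.
Unset Strict Implicit.
Unset Printing Implicit Defensive.
Import Order.TTheory GRing.Theory Num.Theory.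
Local Open Scope classical_set_scope.
Local Open Scope ring_scope.

(* [edge n] is the set E_{n+1} of edges from level n to level n+1. *)
Record bratteli := Bratteli {
  vert : nat -> finType;
  edge : nat -> finType;
  src : forall n, edge n -> vert n;
  tgt : forall n, edge n -> vert n.+1;
  card_vert0 : #|vert 0| = 1%N;
  src_surj : forall n (v : vert n), exists e : edge n, src e = v;
  tgt_surj : forall n (v : vert n.+1), exists e : edge n, tgt e = v
}.
Arguments src {b n}.
Arguments tgt {b n}.

Definition xpath (B : bratteli) : Type :=
  {x : forall n, edge B n | forall n, src (x n.+1) = tgt (x n)}.

Definition xedge (B : bratteli) (x : xpath B) (n : nat) : edge B n := sval x n.
Definition xvert (B : bratteli) (x : xpath B) (n : nat) : vert B n :=
  src (xedge x n).

(* Finite paths from the root to level n, each carrying its end vertex; a path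
   of length n+1 is a path of length n with an edge starting at its end. *)
Fixpoint finpath_data (B : bratteli) (n : nat) : {T : finType & T -> vert B n} :=
  match n with
  | 0 => existT (fun T : finType => T -> vert B 0) (vert B 0) id
  | m.+1 =>
      let s := finpath_data B m in
      existT (fun T : finType => T -> vert B m.+1)
        {u : projT1 s * edge B m | projT2 s u.1 == src u.2}
        (fun u => tgt (sval u).2)
  end.

Definition finpath (B : bratteli) (n : nat) : finType := projT1 (finpath_data B n).
Definition fend (B : bratteli) (n : nat) (e : finpath B n) : vert B n :=
  projT2 (finpath_data B n) e.

Fixpoint starts_with (B : bratteli) (x : xpath B) (n : nat) : finpath B n -> Prop :=
  match n return finpath B n -> Prop with
  | 0 => fun v => xvert x 0 = v
  | m.+1 => fun u => starts_with x (sval u).1 /\ xedge x m = (sval u).2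
  end.

Definition cylinder (B : bratteli) (n : nat) (e : finpath B n) : set (xpath B) :=
  [set x | starts_with x e].

Definition height (B : bratteli) (n : nat) (v : vert B n) : nat :=
  #|[set e : finpath B n | fend e == v]|.

Definition tail_equiv (B : bratteli) (x y : xpath B) : Prop :=
  exists N, forall n, (N <= n)%N -> xedge x n = xedge y n.

(* measurableType requires an inhabited carrier. *)
Lemma xpath_inhabited (B : bratteli) : inhabited (xpath B).
Proof.
have r0 : vert B 0.
  by have := card_vert0 B; case: (pickP (vert B 0)) => // /eq_card0 ->.
pose nxt n (v : vert B n) := projT1 (cid (src_surj v)).
have nxtP n (v : vert B n) : src (nxt n v) = v := projT2 (cid (src_surj v)).
pose vs := fix vs n : vert B n :=
  match n with 0 => r0 | m.+1 => tgt (nxt m (vs m)) end.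
by split; exists (fun n => nxt n (vs n)) => n; rewrite nxtP.
Qed.

Definition xpath_point (B : bratteli) : xpath B :=
  projT1 (cid (let: inhabits x := xpath_inhabited B in
               ex_intro (fun=> True) x I)).

HB.instance Definition _ (B : bratteli) := gen_eqMixin (xpath B).
HB.instance Definition _ (B : bratteli) := gen_choiceMixin (xpath B).
HB.instance Definition _ (B : bratteli) :=
  isPointed.Build (xpath B) (xpath_point B).

Definition cylinders (B : bratteli) : set (set (xpath B)) :=
  [set Z | exists n (e : finpath B n), Z = cylinder e].

HB.instance Definition _ (B : bratteli) :=
  @isSubBaseTopological.Build (xpath B) (set (xpath B)) (@cylinders B) id.

Notation borel B := (g_sigma_algebraType (@open (xpath B))).

Definition nonatomic d (T : measurableType d) (R : realType)
    (mu : {measure set T -> \bar R}) : Prop :=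
  ~ exists Z : set T, [/\ measurable Z, (0 < mu Z)%E &
      forall Y, measurable Y -> Y `<=` Z -> mu Y = 0%E \/ mu (Z `\` Y) = 0%E].

Definition invariant_measure (R : realType) (B : bratteli)
    (mu : {measure set (borel B) -> \bar R}) : Prop :=
  nonatomic mu /\
  forall n (e e' : finpath B n), fend e = fend e' ->
    mu (cylinder e) = mu (cylinder e').

(* [k n] is the n-th kept level of the telescoping. The telescoped diagram has
   the same infinite paths, and its vertices at level n are those at level
   [k n] here, with the same sets of infinite paths through them. *)
Definition exact_finite_rank (R : realType) (B : bratteli) : Prop :=
  (exists d, forall n, (#|vert B n| <= d)%N) /\
  exists (nu : {finite_measure set (borel B) -> \bar R}) (delta : R)
         (k : nat -> nat),
    [/\ invariant_measure nu, 0 < delta, k 0%N = 0%N, {homo k : m n / (m < n)%N} &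
        forall n (v : vert B (k n)), (0 < n)%N ->
          (delta%:E <= nu [set x | xvert x (k n) = v])%E].

Definition comparable_heights (R : realType) (B : bratteli) : Prop :=
  0 < inf [set r : R | exists n (v w : vert B n),
                         r = (height v)%:R / (height w)%:R].

Definition nedges (B : bratteli) (n : nat) (w : vert B n) (v : vert B n.+1)
  : nat := #|[set e : edge B n | (src e == w) && (tgt e == v)]|.

(* [vtx n] numbers the vertices at level n >= 1; at level 0 it is necessarily
   constant, equal to the root. *)
Definition incidence (B : bratteli) (d : nat) (vtx : forall n, 'I_d -> vert B n)
    (n : nat) : 'M[nat]_d :=
  \matrix_(i, j) nedges (vtx n j) (vtx n.+1 i).

Definition vertices_of (B : bratteli) (d m : nat)
    (vtx : forall n, 'I_d -> vert B n) (f : 'I_m -> 'I_d) (n : nat) :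
    {set vert B n} := [set vtx n (f i) | i : 'I_m]%SET.

Record vertex_system (B : bratteli) (W : forall n, {set vert B n}) : Prop :=
  VertexSystem {
    vsys_root : forall v : vert B 0, v \in W 0%N;
    vsys_src : forall n v, v \in W n ->
      exists e : edge B n, src e = v /\ tgt e \in W n.+1;
    vsys_tgt : forall n v, v \in W n.+1 ->
      exists e : edge B n, tgt e = v /\ src e \in W n
  }.

Section Subdiagram.
Variables (B : bratteli) (W : forall n, {set vert B n}).
Hypothesis WP : vertex_system W.

Definition sub_vert n : finType := {v : vert B n | v \in W n}.
Definition sub_edge n : finType :=
  {e : edge B n | (src e \in W n) && (tgt e \in W n.+1)}.
Definition sub_src n (e : sub_edge n) : sub_vert n :=
  exist _ (src (sval e)) (proj1 (andP (svalP e))).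
Definition sub_tgt n (e : sub_edge n) : sub_vert n.+1 :=
  exist _ (tgt (sval e)) (proj2 (andP (svalP e))).

Lemma sub_card_vert0 : #|sub_vert 0| = 1%N.
Proof.
rewrite card_sig -(card_vert0 B); apply: eq_card => v.
by rewrite !inE (vsys_root WP).
Qed.

Lemma sub_src_surj n (v : sub_vert n) : exists e : sub_edge n, sub_src e = v.
Proof.
have [e [ev te]] := vsys_src WP (svalP v).
have eP : (src e \in W n) && (tgt e \in W n.+1) by rewrite ev te (svalP v).
by exists (exist _ e eP); apply: val_inj.
Qed.

Lemma sub_tgt_surj n (v : sub_vert n.+1) :
  exists e : sub_edge n, sub_tgt e = v.
Proof.
have [e [ev se]] := vsys_tgt WP (svalP v).
have eP : (src e \in W n) && (tgt e \in W n.+1) by rewrite ev se (svalP v).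
by exists (exist _ e eP); apply: val_inj.
Qed.

(* The subdiagram with vertex sets [W n] and all the edges of B between them. *)
Definition subdiagram : bratteli :=
  Bratteli sub_card_vert0 sub_src_surj sub_tgt_surj.

Definition sub_xpath (y : xpath subdiagram) : xpath B :=
  exist (fun x : forall n, edge B n => forall n, src (x n.+1) = tgt (x n))
    (fun n => sval (xedge y n)) (fun n => congr1 val (svalP y n)).

Definition is_extension (R : realType)
    (mu : {measure set (borel subdiagram) -> \bar R})
    (muhat : {measure set (borel B) -> \bar R}) : Prop :=
  [/\ invariant_measure muhat,
      muhat (~` [set x | exists y, tail_equiv x (sub_xpath y)]) = 0%E &
      forall Z : set (borel subdiagram), measurable Z ->
        muhat (sub_xpath @` Z) = mu Z].

End Subdiagram.

Definition primitive_mx (d : nat) (M : 'M[nat]_d) : Prop :=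
  exists2 k : nat, (0 < k)%N & forall i j, (0 < (M ^+ k) i j)%N.

(* M_n *m ... *m M_1 *)
Fixpoint mxprod (d : nat) (M : nat -> 'M[nat]_d) (n : nat) : 'M[nat]_d :=
  match n with 0 => 1%:M | m.+1 => M m.+1 *m mxprod M m end.

(* Sum of the entries, which are natural numbers. *)
Definition norm1 (m n : nat) (M : 'M[nat]_(m, n)) : nat :=
  (\sum_(i < m) \sum_(j < n) M i j)%N.

Definition mxmax (m n : nat) (M : 'M[nat]_(m, n)) : nat :=
  \max_(ij : 'I_m * 'I_n) M ij.1 ij.2.

(* The neutral value [mxmax M] bounds every entry, so it does not affect the
   minimum of a nonempty matrix. *)
Definition mxmin (m n : nat) (M : 'M[nat]_(m, n)) : nat :=
  \big[minn/mxmax M]_(ij : 'I_m * 'I_n) M ij.1 ij.2.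

Lemma primitive_entry_row (d : nat) (M : 'M[nat]_d) :
  primitive_mx M -> forall i, exists j, (0 < M i j)%N.
Proof.
move=> [[//|k] _ Mk] i; apply: contrapT => /forallNP M0.
have := Mk i i; rewrite exprS mxE big1 // => j _.
by have /negP := M0 j; rewrite -eqn0Ngt => /eqP ->; rewrite mul0r.
Qed.

Lemma primitive_entry_col (d : nat) (M : 'M[nat]_d) :
  primitive_mx M -> forall j, exists i, (0 < M i j)%N.
Proof.
move=> [[//|k] _ Mk] j; apply: contrapT => /forallNP M0.
have := Mk j j; rewrite exprSr mxE big1 // => i _.
by have /negP := M0 i; rewrite -eqn0Ngt => /eqP ->; rewrite mulr0.
Qed.

Lemma vertices_of_system (B : bratteli) (d m : nat)
    (vtx : forall n, 'I_d -> vert B n) (f : 'I_m -> 'I_d)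
    (M : nat -> 'M[nat]_m) :
  (0 < m)%N ->
  (forall (v : vert B 0) (w : vert B 1), nedges v w = 1%N) ->
  (forall n, (0 < n)%N ->
     forall i j, incidence vtx n (f i) (f j) = M n i j) ->
  (forall n, (0 < n)%N -> primitive_mx (M n)) ->
  vertex_system (vertices_of vtx f).
Proof.
move=> m0 root1 incM Mprim.
have eqv0 (v w : vert B 0) : v = w.
  have /fintype_le1P vE : (#|vert B 0| <= 1)%N by rewrite card_vert0.
  exact: vE.
have W0 (v : vert B 0) : v \in vertices_of vtx f 0.
  by apply/imsetP; exists (Ordinal m0) => //; exact: eqv0.
have edgeP n (w : vert B n) (v : vert B n.+1) :
    (0 < nedges w v)%N -> exists e : edge B n, src e = w /\ tgt e = v.
  by case/card_gt0P => e; rewrite inE => /andP[/eqP <- /eqP <-]; exists e.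
split=> //.
- case=> [|n] v.
  + move=> _; have [|e [ev ew]] := @edgeP 0 v (vtx 1%N (f (Ordinal m0))).
      by rewrite root1.
    by exists e; split=> //; rewrite ew; apply/imsetP; exists (Ordinal m0).
  + case/imsetP => j _ ->.
    have [i] := primitive_entry_col (Mprim n.+1 isT) j.
    rewrite -incM // mxE => /edgeP[e [ev ew]].
    by exists e; split=> //; rewrite ew; apply/imsetP; exists i.
- case=> [|n] v.
  + move=> _; have [e ev] := tgt_surj v.
    by exists e; split.
  + case/imsetP => i _ ->.
    have [j] := primitive_entry_row (Mprim n.+1 isT) i.
    rewrite -incM // mxE => /edgeP[e [ev ew]].
    by exists e; split=> //; rewrite ev; apply/imsetP; exists j.
Qed.

Section Blocks.
Variables (B : bratteli) (p q : nat) (vtx : forall n, 'I_(p + q) -> vert B n).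
Variables (D : nat -> 'M[nat]_p) (A : nat -> 'M[nat]_(q, p)).
Variable (C : nat -> 'M[nat]_q).

Definition WD := vertices_of vtx (@lshift p q).
Definition WC := vertices_of vtx (@rshift p q).

Hypothesis root1 : forall (v : vert B 0) (w : vert B 1), nedges v w = 1%N.
Hypothesis incF : forall n, (0 < n)%N ->
  incidence vtx n = block_mx (D n) 0 (A n) (C n).
Hypothesis D_prim : forall n, (0 < n)%N -> primitive_mx (D n).
Hypothesis C_prim : forall n, (0 < n)%N -> primitive_mx (C n).
Hypothesis A_neq0 : forall n, (0 < n)%N -> A n != 0.

Let pq_gt0 : (0 < p)%N /\ (0 < q)%N.
Proof.
have [i [j _]] : exists i j, A 1%N i j != 0.
  apply: contrapT => H; have /eqP := A_neq0 (ltn0Sn 0); apply.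
  apply/matrixP => i j; rewrite mxE; apply: contrapT => /eqP Aij.
  by apply: H; exists i, j.
by split; [exact: leq_ltn_trans (leq0n j) (ltn_ord j)
         |exact: leq_ltn_trans (leq0n i) (ltn_ord i)].
Qed.

Lemma WD_system : vertex_system WD.
Proof.
case: pq_gt0 => p0 q0; apply: (@vertices_of_system _ _ _ _ _ D) => // n n0 i j.
by rewrite incF // block_mxEul.
Qed.

Lemma WC_system : vertex_system WC.
Proof.
case: pq_gt0 => p0 q0; apply: (@vertices_of_system _ _ _ _ _ C) => // n n0 i j.
by rewrite incF // block_mxEdr.
Qed.

End Blocks.

(* Main.v *)
Require Import Defs.
From HB Require Import structures.
From mathcomp Require Import all_boot all_order all_algebra.
From mathcomp Require Import all_classical all_reals all_analysis.
Set Implicit Arguments.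
Unset Strict Implicit.
Unset Printing Implicit Defensive.
Import Order.TTheory GRing.Theory Num.Theory.
Local Open Scope classical_set_scope.
Local Open Scope ring_scope.

(* Once a path of B is in B(C) at a level n >= 1 it stays there, so up to a
   null set X_B is the disjoint union of the sets [entrance n] of the paths whose
   first vertex in B(C) after the root is at level n+1. With pi_v the mass of a
   cylinder of B(C) ending at v in V_{n+1}(C), invariance of the extension gives
     muhat (entrance n) = sum_v pi_v sum_u a^(n)_{v,u} h_u^(n)(D)   (n >= 1),
   which lies between beta_n and alpha_n times |D_{n-1}...D_1|_1 sum_v pi_v.
   As sum_v pi_v h_v^(n+1)(C) = 1 and sum_v h_v^(n+1)(C) = |C_n...C_1|_1, the
   factor sum_v pi_v is at least 1/|C_n...C_1|_1, and at most a constant times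
   it when the heights in B(C) are comparable. *)

(** * Finite paths, cylinders and the masses an invariant measure gives them *)

Section Paths.
Variable B : bratteli.

Lemma starts_with_ex (x : xpath B) n :
  exists e : finpath B n, starts_with x e /\ fend e = xvert x n.
Proof.
elim: n => [|n [e [xe ev]]]; first by exists (xvert x 0).
have eP : projT2 (finpath_data B n) (e, xedge x n).1 == src (e, xedge x n).2.
  by apply/eqP.
exists (exist _ (e, xedge x n) eP); split=> //.
by rewrite /xvert /xedge (svalP x n).
Qed.

Lemma starts_with_inj (x : xpath B) n (e e' : finpath B n) :
  starts_with x e -> starts_with x e' -> e = e'.
Proof.
elim: n e e' => [|n IH] e e'; first by move=> /= -> ->.
case: e => -[e f] eP; case: e' => -[e' f'] eP' /= [xe xf] [xe' xf'].
by apply: val_inj; rewrite /= (IH _ _ xe xe') -xf -xf'.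
Qed.

Lemma starts_with_end (x : xpath B) n (e : finpath B n) :
  starts_with x e -> fend e = xvert x n.
Proof.
by move=> xe; have [e' [/(starts_with_inj xe) ->]] := starts_with_ex x n.
Qed.

Lemma finpath_surj n (v : vert B n) : exists e : finpath B n, fend e = v.
Proof.
elim: n v => [|n IH] v; first by exists v.
have [f <-] := tgt_surj v; have [e ev] := IH (src f).
have eP : projT2 (finpath_data B n) (e, f).1 == src (e, f).2 by apply/eqP.
by exists (exist _ (e, f) eP).
Qed.

Lemma cylinder_open n (e : finpath B n) : open (cylinder e).
Proof.
exists [set cylinder e]; last by rewrite bigcup_set1.
by move=> _ ->; apply: finI_from1; exists n, e.
Qed.

Lemma cylinder_measurable n (e : finpath B n) :
  measurable (cylinder e : set (borel B)).
Proof. by apply: sub_sigma_algebra; exact: cylinder_open. Qed.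

Lemma trivIset_cylinder n (P : set (finpath B n)) : trivIset P (@cylinder B n).
Proof. by move=> e e' _ _ [x [xe xe']]; exact: (starts_with_inj xe xe'). Qed.

Lemma measure_cylinders (R : realType) (mu : {measure set (borel B) -> \bar R})
    n (P : pred (finpath B n)) :
  mu (\bigcup_(e in [set` P]) cylinder e) =
  (\sum_(e : finpath B n | P e) mu (cylinder e))%E.
Proof.
rewrite measure_fin_bigcup; [|exact: finite_finset|exact: trivIset_cylinder|
  by move=> e _; exact: cylinder_measurable].
by rewrite [RHS]bigfs ?index_enum_uniq// => e _; rewrite mem_index_enum.
Qed.

(* [height] and [nedges] count classical sets; the boolean finite sets below
   give access to the counting lemmas of finset. *)
Lemma heightE n (v : vert B n) :
  height v = #|[set e : finpath B n | fend e == v]%SET|.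
Proof. by apply: eq_card => e; rewrite inE; apply/asboolP/idP. Qed.

Lemma nedgesE n (w : vert B n) (v : vert B n.+1) :
  nedges w v = #|[set e : edge B n | (src e == w) && (tgt e == v)]%SET|.
Proof. by apply: eq_card => e; rewrite inE; apply/asboolP/idP. Qed.

(** A path of length [n.+1] is a pair of a shorter path and a last edge; the pairs are sorted by the
    source of that edge. With [P] always true this is the height recursion, and with [P] the
    complement of a vertex set it counts the paths that enter the set exactly at [v]. *)
Lemma card_last_edge n (P : pred (vert B n)) (v : vert B n.+1) :
  #|[set e : finpath B n.+1 | (fend e == v) && P (src (sval e).2)]%SET| =
  (\sum_(w | P w) height w * nedges w v)%N.
Proof.
rewrite -(card_imset _ val_inj).
set S := [set u : finpath B n * edge B n |
  [&& fend u.1 == src u.2, tgt u.2 == v & P (src u.2)]]%SET.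
have -> : val @: [set e : finpath B n.+1 |
    (fend e == v) && P (src (sval e).2)]%SET = S.
  apply/setP => u; apply/imsetP/idP => [[e]|].
    by rewrite inE => /andP[ev Pe] ->; rewrite inE; apply/and3P; split;
      [exact: svalP e|exact: ev|exact: Pe].
  rewrite inE => /andP[eP uP].
  by exists (exist _ u eP) => //; rewrite inE.
rewrite -sum1_card (partition_big (fun u => src u.2) P) /=; last first.
  by move=> u; rewrite inE => /and3P[].
apply: eq_bigr => w Pw; rewrite heightE nedgesE -finset.cardsX -sum1_card.
apply: eq_bigl => -[e f]; rewrite !inE /=.
by case: (eqVneq (src f) w) => [->|]; rewrite ?Pw ?andbT ?andbF.
Qed.

Lemma heightS n (v : vert B n.+1) :
  height v = (\sum_w height w * nedges w v)%N.
Proof.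
have <- := card_last_edge xpredT v.
by rewrite heightE; apply: eq_card => e; rewrite !inE andbT.
Qed.

(** Glues [e] to a tail. The family [t] need only be a path from level [n] on, so the induction can
    absorb the edges of [e] into [t] one at a time, from the last to the first. *)
Lemma finpath_extension n (e : finpath B n) (t : forall k, edge B k) :
  fend e = src (t n) ->
  (forall k, (n <= k)%N -> src (t k.+1) = tgt (t k)) ->
  exists2 x : xpath B, starts_with x e &
    forall k, (n <= k)%N -> xedge x k = t k.
Proof.
elim: n e t => [|n IH] e t et tP.
  by exists (exist _ t (fun k => tP k (leq0n k))).
case: e et => -[e f] efP et; have ef : fend e = src f by exact/eqP.
have {}et : tgt f = src (t n.+1) by exact: et.
(* The last edge [f] of the finite path overwrites entry [n], so [t'] is a path from level [n] on
   and the junction moves one level down. *)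
pose t' := @dfwith nat (fun k => edge B k) t n f.
have t'P k : (n <= k)%N -> src (t' k.+1) = tgt (t' k).
  rewrite leq_eqVlt => /predU1P[<-|nk].
    by rewrite /t' dfwithin dfwithout// neq_ltn leqnn.
  by rewrite /t' !dfwithout// ?neq_ltn ?nk ?ltnS ?(ltnW nk)//; exact: tP.
have [|x xe xt] := IH e t' _ t'P; first by rewrite /t' dfwithin.
exists x; first by split=> //; rewrite xt// /t' dfwithin.
by move=> k nk; rewrite xt 1?ltnW// /t' dfwithout// neq_ltn nk.
Qed.

Lemma invariant_mass (R : realType) (mu : probability (borel B) R) n :
  invariant_measure mu ->
  exists p : vert B n -> R,
    [/\ forall v, 0 <= p v,
        forall e : finpath B n, mu (cylinder e) = (p (fend e))%:E &
        \sum_v p v * (height v)%:R = 1].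
Proof.
move=> [_ inv]; pose e0 v := projT1 (cid (@finpath_surj n v)).
have e0E v : fend (e0 v) = v by exact: projT2 (cid (@finpath_surj n v)).
exists (fun v => fine (mu (cylinder (e0 v)))).
have pE e : mu (cylinder e) = (fine (mu (cylinder (e0 (fend e)))))%:E.
  by rewrite (inv n _ e (e0E _)) fineK// fin_num_measure//;
     exact: cylinder_measurable.
split=> //; first by move=> v; rewrite fine_ge0.
apply: EFin_inj; rewrite -(@probability_setT _ _ _ mu).
(* The cylinders of length [n] partition the path space; sorting them by end vertex turns total mass
   1 into the weighted sum of heights. *)
have -> : [set: borel B] = \bigcup_(e in [set` xpredT]) @cylinder B n e.
  apply/seteqP; split=> // x _.
  by have [e [xe _]] := starts_with_ex x n; exists e.
rewrite measure_cylinders (eq_bigr _ (fun e _ => pE e)) sumEFin.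
rewrite (partition_big (@fend B n) xpredT)//=; congr EFin.
apply: eq_bigr => v _; rewrite heightE -sum1_card natr_sum mulr_sumr.
by apply: eq_big => [e|e]; rewrite inE// => /eqP ->; rewrite mulr1.
Qed.

End Paths.

(** * Subdiagrams that no path leaves, and the decomposition by entrance level *)

Section Subdiagram.
Variables (B : bratteli) (W : forall n, {set vert B n}).
Hypothesis WP : vertex_system W.
(* Not at level 0: the root belongs to [W 0] but has edges out of [W 1]. *)
Hypothesis W_closed : forall n (f : edge B n), (0 < n)%N ->
  src f \in W n -> tgt f \in W n.+1.
Local Notation BW := (subdiagram WP).

(** The last clause says that [e'] stays in [W]; it is what later allows paths of [B] starting with
    [e'] to be pulled back to the subdiagram. *)
Lemma sub_finpath n (e : finpath BW n) : exists e' : finpath B n,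
  [/\ fend e' = val (fend e),
      forall y : xpath BW, starts_with (sub_xpath y) e' <-> starts_with y e &
      forall x : xpath B, starts_with x e' -> forall k, (k < n)%N ->
        (src (xedge x k) \in W k) && (tgt (xedge x k) \in W k.+1)].
Proof.
elim: n e => [|n IH] e.
  exists (val e); split=> // y; split => [yv|<- //].
  exact: val_inj.
case: e => -[e f] efP; have ef : fend e = src f by exact/eqP.
have [e' [e'v e'y e'W]] := IH e.
have e'P : projT2 (finpath_data B n) (e', val f).1 == src (e', val f).2.
  by apply/eqP; move/(congr1 val): ef; rewrite -[LHS]e'v.
exists (exist _ (e', val f) e'P); split=> //= [y|x [xe' xf] k].
  split=> [[/e'y ? yf]|[/e'y ? yf]]; split=> //; last by rewrite -yf.
  exact: val_inj.
rewrite ltnS leq_eqVlt => /predU1P[->|]; last exact: e'W.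
by rewrite xf; exact: (svalP f).
Qed.

Lemma sub_xpath_onto (x : xpath B) :
  (forall k, (src (xedge x k) \in W k) && (tgt (xedge x k) \in W k.+1)) ->
  exists y : xpath BW, sub_xpath y = x.
Proof.
move=> xW; pose y k : edge BW k := exist _ (xedge x k) (xW k).
have yP k : src (y k.+1) = tgt (y k) by apply: val_inj; exact: svalP x k.
by exists (exist _ y yP); case: x xW @y yP => x xP xW y yP; exact: eq_exist.
Qed.

Lemma xvert_closed (x : xpath B) n m : (0 < n <= m)%N ->
  xvert x n \in W n -> xvert x m \in W m.
Proof.
case/andP=> n0; elim: m => [|m IH]; first by rewrite leqn0 => /eqP ->.
rewrite leq_eqVlt => /predU1P[-> //|nm] /(IH nm) xm.
rewrite /xvert (svalP x m); apply: W_closed xm; exact: leq_trans n0 nm.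
Qed.

Lemma xpath_closed (x : xpath B) n : (0 < n)%N -> xvert x n \in W n ->
  (forall k, (k < n)%N ->
     (src (xedge x k) \in W k) && (tgt (xedge x k) \in W k.+1)) ->
  exists y : xpath BW, sub_xpath y = x.
Proof.
move=> n0 xn xW; apply: sub_xpath_onto => k; have [/xW //|nk] := ltnP k n.
have xk : xvert x k \in W k by apply: xvert_closed xn; rewrite n0.
by rewrite xk W_closed// (leq_trans n0).
Qed.

(** Since paths cannot leave [W] after level 0, every continuation in [B] of a nonempty path of the
    subdiagram remains in it. For [n = 0] the cylinder in [B] is the whole path space, so positivity
    is required. *)
Lemma sub_cylinder n (e : finpath BW n) : (0 < n)%N ->
  exists2 e' : finpath B n, fend e' = val (fend e) &
    cylinder e' = sub_xpath (WP := WP) @` cylinder e.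
Proof.
move=> n0; have [e' [e'v e'y e'W]] := sub_finpath e.
exists e' => //; apply/seteqP; split=> [x xe'|_ [y ye <-]]; last exact/e'y.
have [|y yx] := xpath_closed n0 _ (e'W _ xe').
  by rewrite -(starts_with_end xe') e'v; exact: valP.
by exists y => //; apply/e'y; rewrite yx.
Qed.

Lemma cofinal_sub_xpath (x : xpath B) :
  (exists y : xpath BW, tail_equiv x (sub_xpath y)) <->
  exists n, xvert x n.+1 \in W n.+1.
Proof.
split=> [[y [n xy]]|[n xn]].
  by exists n; rewrite /xvert xy//; exact: valP (src (xedge y n.+1)).
(* The beginning of [x] is replaced by a path of the subdiagram to the same vertex; the tail already
   lies in [W]. *)
have [e ev] := @finpath_surj BW n.+1 (exist (fun v => v \in W n.+1) _ xn).
have [e' [e'v _ e'W]] := sub_finpath e.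
have [|//|z ze' zx] := @finpath_extension _ _ e' (xedge x).
- by rewrite e'v ev.
- by move=> k _; exact: svalP x k.
have [//||y yz] := xpath_closed _ _ (e'W _ ze').
  by rewrite -(starts_with_end ze') e'v; exact: valP.
by exists y, n.+1 => k nk; rewrite yz zx.
Qed.

(* The paths whose first vertex in [W] after the root is at level [n.+1]. *)
Definition entrance n : set (xpath B) :=
  [set x | xvert x n.+1 \in W n.+1 /\ ((0 < n)%N -> xvert x n \notin W n)].

(** Membership depends only on the first [n.+1] edges: the vertex at level [n] is the source of the
    last of them. *)
Lemma entranceE n : entrance n =
  \bigcup_(e in [set` [pred e : finpath B n.+1 | (fend e \in W n.+1) &&
    ((n == 0%N) || (src (sval e).2 \notin W n))]]) cylinder e.
Proof.
apply/seteqP; split=> [x [xS xn]|x [e /andP[eS en] xe]].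
  have [e [xe ex]] := starts_with_ex x n.+1; exists e => //.
  apply/andP; split; first by rewrite ex.
  by rewrite -(proj2 xe); case: (posnP n) => [-> //|/xn ->]; rewrite orbT.
split; first by rewrite -(starts_with_end xe).
by move=> n0; move: en => /=; rewrite gtn_eqF//= -(proj2 xe).
Qed.

Lemma entrance_measurable n : measurable (entrance n : set (borel B)).
Proof.
rewrite entranceE; apply: fin_bigcup_measurable => [|e _].
  exact: finite_finset.
exact: cylinder_measurable.
Qed.

Lemma trivIset_entrance : trivIset setT entrance.
Proof.
move=> m n _ _ [x [[xm Nm] [xn Nn]]].
have [mn|nm|//] := ltngtP m n.
- have n0 : (0 < n)%N by exact: leq_ltn_trans mn.
  by have := Nn n0; rewrite (xvert_closed _ xm).
- have m0 : (0 < m)%N by exact: leq_ltn_trans nm.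
  by have := Nm m0; rewrite (xvert_closed _ xn).
Qed.

Lemma cofinal_entrance :
  [set x | exists y : xpath BW, tail_equiv x (sub_xpath y)] =
  \bigcup_n entrance n.
Proof.
apply/seteqP; split=> [x /cofinal_sub_xpath xW|x [n _ [xn _]]]; last first.
  by apply/cofinal_sub_xpath; exists n.
(* The entrance level is the least one at which [x] is in [W]; minimality excludes the preceding
   level. *)
pose n := ex_minn xW; exists n => //; rewrite /n.
case: ex_minnP => -[|m] xm min_m; split=> // _; apply/negP => /min_m.
by rewrite ltnn.
Qed.

(** * Masses of the entrance sets under the extension *)

Section Measure.
Variables (R : realType) (mu : {measure set (borel BW) -> \bar R}).
Variable muhat : {measure set (borel B) -> \bar R}.
Hypothesis ext : is_extension mu muhat.

Lemma extension_total :
  (muhat [set: borel B] = \sum_(n <oo) muhat (entrance n))%E.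
Proof.
case: ext => _ null _; rewrite -measure_semi_bigcup//; last 3 first.
- exact: entrance_measurable.
- exact: trivIset_entrance.
- by apply: bigcupT_measurable; exact: entrance_measurable.
move: null; rewrite cofinal_entrance => null.
have mU : measurable (\bigcup_n entrance n : set (borel B)).
  by apply: bigcupT_measurable; exact: entrance_measurable.
rewrite -(setvU (\bigcup_n entrance n)) measureU//; last 2 first.
- exact: measurableC.
- by rewrite setICl.
by rewrite [X in (X + _)%E]null add0e.
Qed.

(** The path [e] may run outside the subdiagram. Invariance of [muhat] replaces it by a path inside
    with the same end, whose cylinder is the image of a cylinder of the subdiagram. *)
Lemma extension_cylinder n (p : vert BW n -> R) (e : finpath B n)
    (v : vert BW n) : (0 < n)%N ->
  (forall e : finpath BW n, mu (cylinder e) = (p (fend e))%:E) ->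
  fend e = val v -> muhat (cylinder e) = (p v)%:E.
Proof.
move=> n0 pE ev; case: ext => -[_ inv] _ muE.
have [f fv] := finpath_surj v; have [f' f'v f'E] := sub_cylinder f n0.
rewrite (inv _ _ f'); last by rewrite ev f'v fv.
rewrite f'E muE; last exact: cylinder_measurable.
by rewrite pE fv.
Qed.

Lemma extension_entrance n (p : vert BW n.+1 -> R) :
  (forall e : finpath BW n.+1, mu (cylinder e) = (p (fend e))%:E) ->
  muhat (entrance n) = (\sum_v p v * (\sum_(w | (n == 0%N) || (w \notin W n))
    height w * nedges w (val v))%:R)%:E.
Proof.
move=> pE; rewrite entranceE measure_cylinders.
(* [q] extends [p] by 0 to all vertices of [B], so that the sum over paths of [B] can be sorted by
   their end. *)
pose q v : R := if insub v is Some v' then p v' else 0.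
have qE (v : vert BW n.+1) : q (val v) = p v by rewrite /q valK.
rewrite (eq_bigr (fun e => (q (fend e))%:E)) => [|e /andP[eW _]]; last first.
  rewrite (@extension_cylinder _ p e (exist (fun v => v \in W n.+1) _ eW))//.
  by rewrite -qE.
rewrite sumEFin (partition_big (@fend B n.+1) (mem (W n.+1))) /=; last first.
  by move=> e /andP[].
congr EFin.
have -> : \sum_v p v * (\sum_(w | (n == 0%N) || (w \notin W n))
    height w * nedges w (val v))%:R = \sum_(v in W n.+1) q v *
    (\sum_(w | (n == 0%N) || (w \notin W n)) height w * nedges w v)%:R.
  rewrite [RHS]big_sub.
  by apply: eq_bigr => v _; rewrite -qE.
apply: eq_bigr => v vW; rewrite -card_last_edge -sum1_card natr_sum mulr_sumr.
apply: eq_big => [e|e /andP[_ /eqP ->]]; last by rewrite mulr1.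
rewrite inE andbC; by case: eqVneq => // ->; rewrite vW.
Qed.

End Measure.

End Subdiagram.


(** * Edge counts, matrix products and height bounds *)

Lemma sub_nedges (B : bratteli) (W : forall n, {set vert B n})
    (WP : vertex_system W) n (w : vert (subdiagram WP) n)
    (v : vert (subdiagram WP) n.+1) :
  nedges w v = nedges (val w) (val v).
Proof.
rewrite !nedgesE -(card_imset _ val_inj); apply: eq_card => f.
rewrite [RHS]inE; apply/imsetP/andP => [[e]|[/eqP fw /eqP fv]].
  rewrite inE => /andP[/eqP <- /eqP <-] ->.
  by split.
have fW : (src f \in W n) && (tgt f \in W n.+1).
  by rewrite fw fv; apply/andP; split; exact: valP.
exists (exist (fun f => (src f \in W n) && (tgt f \in W n.+1)) f fW) => //.
by rewrite inE; apply/andP; split; apply/eqP; apply: val_inj.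
Qed.

Lemma height1 (B : bratteli) (v : vert B 1) :
  (forall (v : vert B 0) (w : vert B 1), nedges v w = 1%N) -> height v = 1%N.
Proof.
move=> root1; rewrite heightS (eq_bigr (fun=> 1%N)) => [|w _].
  by rewrite sum1_card card_vert0.
rewrite root1 muln1 heightE -(card_vert0 B); apply: eq_card => e.
have /fintype_le1P vE : (#|vert B 0| <= 1)%N by rewrite card_vert0.
by rewrite !inE; apply/eqP; exact: vE.
Qed.

(** Matrix indices start at 1 and each vertex of level 1 has height 1, so the product of the first
    [n] matrices counts paths from level 1 to level [n.+1]. *)
Lemma mxprod_rowsum (m : nat) (M : nat -> 'M[nat]_m) (h : nat -> 'I_m -> nat) :
  (forall i, h 1%N i = 1%N) ->
  (forall n i, h n.+2 i = \sum_(j < m) h n.+1 j * M n.+1 i j)%N ->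
  forall n i, h n.+1 i = (\sum_(k < m) mxprod M n i k)%N.
Proof.
move=> h1 hS; elim=> [|n IH] i.
  rewrite h1 (bigD1 i)//= mxE eqxx big1 ?addn0// => j ji.
  by rewrite mxE eq_sym (negbTE ji).
rewrite hS; under [RHS]eq_bigr do rewrite mxE.
rewrite [RHS]exchange_big/=; apply: eq_bigr => j _.
by rewrite IH mulnC big_distrr.
Qed.

Lemma leq_mxmax (m n : nat) (M : 'M[nat]_(m, n)) i j : (M i j <= mxmax M)%N.
Proof. exact: (leq_bigmax (i, j)). Qed.

Lemma mxmin_leq (m n : nat) (M : 'M[nat]_(m, n)) i j : (mxmin M <= M i j)%N.
Proof.
rewrite /mxmin; have := mem_index_enum (i, j).
elim: (index_enum _) => // ij s IH; rewrite big_cons in_cons geq_min.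
by case/predU1P=> [<-|/IH ->]; rewrite ?leqnn ?orbT.
Qed.

Lemma comparable_heightsP (R : realType) (B : bratteli) :
  comparable_heights R B -> exists2 c : R, 0 < c &
    forall n (v w : vert B n), c * (height w)%:R <= (height v)%:R.
Proof.
rewrite /comparable_heights; set E := (X in inf X); exists (inf E) => // n v w.
have lbE : has_lbound E by exists 0 => _ [k [x [y ->]]]; exact: divr_ge0.
(* At height 0 the quotient would be meaningless, but the product inequality is trivial. *)
have [->|w0] := posnP (height w); first by rewrite mulr0.
rewrite -ler_pdivlMr ?ltr0n//; apply: ge_inf => //.
by exists n, v, w.
Qed.

(** * Heights and entrance counts for block triangular incidence matrices *)

Section Blocks.
Variables (p q : nat) (B : bratteli) (vtx : forall n, 'I_(p + q) -> vert B n).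
Variables (D : nat -> 'M[nat]_p) (A : nat -> 'M[nat]_(q, p)).
Variable C : nat -> 'M[nat]_q.
Hypothesis vtx_bij : forall n, (0 < n)%N -> bijective (vtx n).
Hypothesis root1 : forall (v : vert B 0) (w : vert B 1), nedges v w = 1%N.
Hypothesis incF : forall n, (0 < n)%N ->
  incidence vtx n = block_mx (D n) 0 (A n) (C n).
Hypothesis WP : vertex_system (WC vtx).
Local Notation BC := (subdiagram WP).

Lemma sum_vtx (V : nmodType) n (P : pred (vert B n)) (F : vert B n -> V) :
  (0 < n)%N ->
  \sum_(w | P w) F w =
    \sum_(j < p | P (vtx n (lshift q j))) F (vtx n (lshift q j)) +
    \sum_(i < q | P (vtx n (rshift p i))) F (vtx n (rshift p i)).
Proof.
move=> n0; rewrite (reindex (vtx n)) ?big_split_ord//.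
exact: onW_bij (vtx_bij n0).
Qed.

Lemma nedges_vtx n i j : (0 < n)%N ->
  nedges (vtx n j) (vtx n.+1 i) = block_mx (D n) 0 (A n) (C n) i j.
Proof. by move=> n0; rewrite -incF// mxE. Qed.

Lemma vtx_rshift_WC n i : vtx n (rshift p i) \in WC vtx n.
Proof. exact: imset_f. Qed.

Lemma vtx_lshift_WC n j : (0 < n)%N -> vtx n (lshift q j) \notin WC vtx n.
Proof.
move=> n0; apply/imsetP => -[i _ /(bij_inj (vtx_bij n0))/eqP].
by rewrite eq_lrshift.
Qed.

(** The zero upper right block of the incidence matrix forbids edges from a vertex of B(C) to one of
    B(D). *)
Lemma WC_closed n (f : edge B n) : (0 < n)%N ->
  src f \in WC vtx n -> tgt f \in WC vtx n.+1.
Proof.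
move=> n0 /imsetP[i _ fi]; have [g _ gK] := vtx_bij (ltn0Sn n).
rewrite -(gK (tgt f)); case: (split_ordP (g (tgt f))) => [j gj|j ->]; last first.
  exact: vtx_rshift_WC.
have := nedges_vtx (lshift q j) (rshift p i) n0; rewrite block_mxEur mxE.
rewrite nedgesE => /eqP; rewrite cards_eq0 => /eqP/setP/(_ f).
by rewrite !inE -gj gK fi !eqxx.
Qed.

Definition cvtx n (i : 'I_q) : vert BC n :=
  exist (fun v => v \in WC vtx n) _ (vtx_rshift_WC n i).

Lemma cvtx_bij n : (0 < n)%N -> bijective (cvtx n).
Proof.
move=> n0; apply: inj_card_bij => [i j /(congr1 val)|].
  by move/(bij_inj (vtx_bij n0))/rshift_inj.
(* Surjectivity comes from counting: [WC vtx n] is an image of ['I_q]. *)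
rewrite [X in (X <= _)%N]card_sig card_ord.
apply: leq_trans (leq_imset_card (fun i => vtx n (rshift p i)) predT) _.
by rewrite card_ord.
Qed.

Lemma sum_cvtx (V : nmodType) n (F : vert BC n -> V) : (0 < n)%N ->
  \sum_v F v = \sum_(i < q) F (cvtx n i).
Proof.
by move=> n0; rewrite (reindex (cvtx n))//; exact: onW_bij (cvtx_bij n0).
Qed.

(** All edges into a vertex of B(D) beyond level 1 come from B(D), so its height in [B] obeys the
    recursion of the matrices [D] alone. *)
Lemma height_lshift n j :
  height (vtx n.+1 (lshift q j)) = (\sum_(k < p) mxprod D n j k)%N.
Proof.
apply: (mxprod_rowsum (h := fun n j => height (vtx n (lshift q j)))) => [i|m i].
  exact: height1.
rewrite heightS; rewrite (sum_vtx xpredT (fun w => height w * nedges w _)%N)//=.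
rewrite [X in _ + X]big1 => [|k _]; last first.
  by rewrite nedges_vtx// block_mxEur mxE muln0.
rewrite addr0; apply: eq_bigr => k _.
by rewrite nedges_vtx// block_mxEul.
Qed.

Lemma height_cvtx n i :
  height (cvtx n.+1 i) = (\sum_(k < q) mxprod C n i k)%N.
Proof.
apply: (mxprod_rowsum (h := fun n j => height (cvtx n j))) => [{}i|m {}i].
  by apply: height1 => v w; rewrite sub_nedges root1.
rewrite heightS (sum_cvtx (fun w => height w * nedges w _)%N)//.
by apply: eq_bigr => k _; rewrite sub_nedges nedges_vtx// block_mxEdr.
Qed.

Lemma entrance_height n i :
  (\sum_(w | (n.+1 == 0%N) || (w \notin WC vtx n.+1))
    height w * nedges w (val (cvtx n.+2 i)) =
   \sum_(j < p) (\sum_(k < p) mxprod D n j k) * A n.+1 i j)%N.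
Proof.
rewrite (sum_vtx _ (fun w => height w * nedges w _)%N)//=.
rewrite [X in _ + X]big_pred0 => [|k]; last by rewrite vtx_rshift_WC.
rewrite addr0; apply: eq_big => [k|k _]; first by rewrite vtx_lshift_WC.
by rewrite nedges_vtx// block_mxEdl height_lshift.
Qed.

(** * Bounds for the mass of each entrance set *)

Section Mass.
Variables (R : realType) (mu : probability (borel BC) R).
Variable muhat : {measure set (borel B) -> \bar R}.
Hypothesis mu_inv : invariant_measure mu.
Hypothesis ext : is_extension mu muhat.

Lemma entrance_mass n : exists pi : 'I_q -> R,
  [/\ forall i, 0 <= pi i,
      \sum_i pi i * (height (cvtx n.+2 i))%:R = 1 &
      muhat (entrance (WC vtx) n.+1) = (\sum_i pi i *
        (\sum_(j < p) (\sum_(k < p) mxprod D n j k) * A n.+1 i j)%:R)%:E].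
Proof.
(* Paths in [entrance n.+1] reach B(C) at level [n.+2], so this is where the cylinder masses are
   taken. *)
have [pi [pi0 piE pi1]] := invariant_mass n.+2 mu_inv.
exists (pi \o cvtx n.+2); split=> [i||]; first exact: pi0.
  by rewrite sum_cvtx in pi1.
rewrite (extension_entrance WC_closed ext piE) sum_cvtx//.
by congr EFin; apply: eq_bigr => i _; rewrite entrance_height.
Qed.

Lemma entrance0_fin : (muhat (entrance (WC vtx) 0) < +oo)%E.
Proof.
have [pi [_ piE _]] := invariant_mass 1 mu_inv.
by rewrite (extension_entrance WC_closed ext piE) ltry.
Qed.

Lemma norm1_height n :
  (norm1 (mxprod C n))%:R = \sum_i (height (cvtx n.+1 i))%:R :> R.
Proof.
by rewrite natr_sum; apply: eq_bigr => i _; rewrite height_cvtx.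
Qed.

Lemma entrance_ge n :
  (((mxmin (A n.+1))%:R * (norm1 (mxprod D n))%:R
      / (norm1 (mxprod C n.+1))%:R : R)%:E
    <= muhat (entrance (WC vtx) n.+1))%E.
Proof.
have [pi [pi0 pi1 ->]] := entrance_mass n; rewrite lee_fin.
(* Each height is at most the sum of all heights at its level, so replacing it by that sum can only
   increase the weighted sum, which is 1. *)
have N1 : 1 <= (\sum_i pi i) * (norm1 (mxprod C n.+1))%:R.
  rewrite -[leLHS]pi1 mulr_suml; apply: ler_sum => i _; rewrite ler_wpM2l//.
  rewrite norm1_height; rewrite (bigD1 i)//= lerDl; exact: sumr_ge0.
(* A zero norm would turn [N1] into 1 <= 0. *)
have N0 : 0 < (norm1 (mxprod C n.+1))%:R :> R.
  rewrite lt0r ler0n andbT; apply/eqP => N0; move: N1.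
  by rewrite N0 mulr0 ler10.
apply: (@le_trans _ _ ((mxmin (A n.+1))%:R * (norm1 (mxprod D n))%:R *
    \sum_i pi i)).
  by rewrite ler_wpM2l// -[leLHS]mul1r ler_pdivrMr.
rewrite mulr_sumr; apply: ler_sum => i _; rewrite mulrC ler_wpM2l//.
rewrite -natrM ler_nat mulnC big_distrl/=; apply: leq_sum => j _.
by rewrite leq_mul2l mxmin_leq orbT.
Qed.

(** Summing c h_j <= h_i over j gives c |C_{n+1}...C_1|_1 <= q h_i. Weighting by pi_i and summing
    over i bounds the sum of the pi_i by q / (c |C_{n+1}...C_1|_1), hence the constant
    [q%:R / c]. *)
Lemma entrance_le (c : R) : 0 < c ->
  (forall n (v w : vert BC n), c * (height w)%:R <= (height v)%:R) ->
  forall n, (muhat (entrance (WC vtx) n.+1) <=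
    (q%:R / c * ((mxmax (A n.+1))%:R * (norm1 (mxprod D n))%:R
      / (norm1 (mxprod C n.+1))%:R))%:E)%E.
Proof.
move=> c0 cP n; have [pi [pi0 pi1 ->]] := entrance_mass n; rewrite lee_fin.
have N1 : (\sum_i pi i) * (norm1 (mxprod C n.+1))%:R <= q%:R / c.
  rewrite ler_pdivlMr// -[leRHS]mulr1 -[X in _ <= _ * X]pi1 mulr_sumr.
  rewrite -mulrA mulr_suml.
  apply: ler_sum => i _; rewrite [leRHS]mulrCA ler_wpM2l//.
  rewrite norm1_height mulrC mulr_sumr.
  apply: le_trans (ler_sum _ (fun j _ => cP _ (cvtx n.+2 i) (cvtx n.+2 j))) _.
  by rewrite sumr_const card_ord mulr_natl.
(* If the norm vanished, all heights would be 0, against the normalization [pi1]. *)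
have N0 : 0 < (norm1 (mxprod C n.+1))%:R :> R.
  rewrite lt0r ler0n andbT norm1_height; apply/eqP => /eqP.
  rewrite psumr_eq0// => /allP h0; move/eqP: pi1; rewrite big1 => [|i _].
    by rewrite eq_sym oner_eq0.
  by have /eqP -> := h0 i (mem_index_enum _); rewrite mulr0.
apply: (@le_trans _ _ ((mxmax (A n.+1))%:R * (norm1 (mxprod D n))%:R *
    \sum_i pi i)); last first.
  by rewrite [leRHS]mulrCA ler_wpM2l// ler_pdivlMr.
rewrite mulr_sumr; apply: ler_sum => i _; rewrite [leRHS]mulrC ler_wpM2l//.
rewrite -natrM ler_nat mulnC big_distrl/=; apply: leq_sum => j _.
by rewrite leq_mul2l leq_mxmax orbT.
Qed.

End Mass.

End Blocks.

(** * Comparison of the total mass with the two series *)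

Theorem theorem6p3 (R : realType) (p q : nat) (B : bratteli)
    (vtx : forall n, 'I_(p + q) -> vert B n)
    (D : nat -> 'M[nat]_p) (A : nat -> 'M[nat]_(q, p)) (C : nat -> 'M[nat]_q)
    (vtx_bij : forall n, (0 < n)%N -> bijective (vtx n))
    (root1 : forall (v : vert B 0) (w : vert B 1), nedges v w = 1%N)
    (no_isolated_point : forall x : xpath B, ~ open [set x])
    (no_finite_class : forall x : xpath B, infinite_set [set y | tail_equiv x y])
    (incF : forall n, (0 < n)%N ->
       incidence vtx n = block_mx (D n) 0 (A n) (C n))
    (D_prim : forall n, (0 < n)%N -> primitive_mx (D n))
    (C_prim : forall n, (0 < n)%N -> primitive_mx (C n))
    (A_neq0 : forall n, (0 < n)%N -> A n != 0) :
  let BD := subdiagram (WD_system root1 incF D_prim A_neq0) in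
  let BC := subdiagram (WC_system root1 incF C_prim A_neq0) in
  forall (mu : probability (borel BC) R)
         (muhat : {measure set (borel B) -> \bar R}),
  invariant_measure mu ->
  is_extension mu muhat ->
  exact_finite_rank R BC ->
  exact_finite_rank R BD ->
  comparable_heights R BD ->
  comparable_heights R BC ->
  let alpha i := mxmax (A i) in
  let beta i := mxmin (A i) in
  ((\sum_(1 <= i <oo)
      (((alpha i)%:R * (norm1 (mxprod D i.-1))%:R
        / (norm1 (mxprod C i))%:R : R)%:E) < +oo)%E ->
   (muhat [set: borel B] < +oo)%E) /\
  ((muhat [set: borel B] < +oo)%E ->
   (\sum_(1 <= i <oo)
      (((beta i)%:R * (norm1 (mxprod D i.-1))%:R
        / (norm1 (mxprod C i))%:R : R)%:E) < +oo)%E).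
Proof.
move=> BD BC mu muhat mu_inv ext _ _ _ /comparable_heightsP[c c0 cP] alpha beta.
have WCP := WC_closed vtx_bij incF.
have tot := extension_total WCP ext.
(* The paths meeting B(C) at level 1 are split off; the remaining entrance sets carry the index i >=
   1 of the two series, and i = n+1 matches [i.-1] with the product of the first n matrices [D]. *)
rewrite nneseries_recl// eseries_cond in tot.
have termE (a : nat -> nat) i : (0 : R) <=
    (a i)%:R * (norm1 (mxprod D i.-1))%:R / (norm1 (mxprod C i))%:R.
  by rewrite divr_ge0.
split=> [alpha_fin|].
- rewrite tot lte_add_pinfty//; first exact: (entrance0_fin vtx_bij incF mu_inv ext).
  apply: (@le_lt_trans _ _ (\sum_(1 <= i <oo) ((q%:R / c)%:E *
      ((alpha i)%:R * (norm1 (mxprod D i.-1))%:R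
        / (norm1 (mxprod C i))%:R)%:E))%E); last first.
    rewrite nneseriesZl => [|i _]; last by rewrite lee_fin.
    by rewrite lte_mul_pinfty// lee_fin divr_ge0// ltW.
  rewrite [leRHS]eseries_cond; apply: lee_nneseries => // -[//|n] _.
  exact: (entrance_le vtx_bij root1 incF mu_inv ext c0 cP).
- move=> fin; rewrite eseries_cond; apply: le_lt_trans fin; rewrite tot.
  (* The mass of [entrance] at 0 is bounded below by 0, the other terms one by one. *)
  rewrite -[leLHS]add0e leeD//; apply: lee_nneseries => [i _ _|[//|n] _].
    by rewrite lee_fin.
  exact: (entrance_ge vtx_bij root1 incF mu_inv ext).
Qed.
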